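(* Let $K$ be a number field and $\mathcal{X}=(X;P_1,m_1;\dots;P_r,m_r)$ an $M$-curve over $K$ with $1<m_i<\infty$ for all $i$. Let $S$ be a finite set of places of $K$ containing all infinite places and all primes of bad reduction, and let $\underline{X}$ be a smooth proper model of $X$ over $\mathcal{O}_{K,S}$. For $P$ with $m_P>1$ let $\mathcal{X}(P;K)=\{t\in X(K): H(P,t)=1\}$. Then: (1) $\mathcal{X}(\mathcal{O}_{K,S,\underline{X}})\subseteq\bigcap_{m_P>1}\mathcal{X}(P;K)$; (2) if $K=\mathbb{Q}$, then $\mathcal{X}(\mathcal{O}_{K,S,\underline{X}})=\bigcap_{m_P>1}\mathcal{X}(P;K)$; that is, the $S$-integral points of $\mathcal{X}$ are exactly the points $t$ with $H(P,t)=1$ for all $P$ with $m_P>1$.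
   Context: An $M$-curve over $K$ consists of a smooth projective curve $X/K$ together with a multiplicity $m_P\in\mathbb{Z}_{\ge1}\cup\{\infty\}$ for each $P\in X(K)$, with $m_P=1$ for all but finitely many $P$; the notation $(X;P_1,m_1;\dots;P_r,m_r)$ means $m_{P_i}=m_i$ and $m_Q=1$ otherwise. For distinct $P,Q\in X(K)$ and a place $\nu\notin S$ with prime ideal $\mathfrak{p}_\nu$, the intersection multiplicity $(P\cdot Q)_\nu$ is the largest $m$ such that the images of $P$ and $Q$ in $\underline{X}(\mathcal{O}_{K,S}/\mathfrak{p}_\nu^m)$ coincide (0 if none). For $t\neq P$ set $\lambda(P,t)=\prod_{\nu\notin S}\mathrm{N}(\mathfrak{p}_\nu)^{(t\cdot P)_\nu}$ (a positive integer) and $H(P,t)$ = the $m_P$-free part of $\lambda(P,t)$ (i.e. $\lambda(P,t)$ divided by the largest $m_P$-th power of an integer dividing it), with $H(P,t)=1$ if $m_P=1$. The set $\mathcal{X}(\mathcal{O}_{K,S,\underline{X}})$ of $S$-integral points (Darmon) consists of $t\in X(K)$ with $(t\cdot P)_\nu\equiv 0\pmod{m_P}$ for all $P\in X(K)$ and all $\nu\notin S$. *)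

(* Defs.v *)
From HB Require Import structures.
From mathcomp Require Import all_boot all_order all_algebra all_field.
From mathcomp Require Import finmap.
From mathcomp Require Import boolp classical_sets functions cardinality fsbigop.
Set Implicit Arguments.
Unset Strict Implicit.
Unset Printing Implicit Defensive.
Import GRing.Theory.
Local Open Scope classical_set_scope.
Local Open Scope ring_scope.

Definition is_ideal (A : comPzRingType) (I : set A) : Prop :=
  [/\ I 0, (forall x y, I x -> I y -> I (x + y)) &
      (forall a x, I x -> I (a * x))].

Definition is_prime_ideal (A : comPzRingType) (I : set A) : Prop :=
  [/\ is_ideal I, ~ I 1 & forall x y, I (x * y) -> I x \/ I y].

Definition ideal_gen (A : comPzRingType) (E : set A) : set A :=
  [set x | forall I : set A, is_ideal I -> E `<=` I -> I x].

Definition ideal_pow (A : comPzRingType) (I : set A) (m : nat) : set A :=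
  ideal_gen [set x | exists2 a : 'I_m -> A,
                      (forall i, I (a i)) & x = \prod_(i < m) a i].

Definition cosets (A : comPzRingType) (I : set A) : set (set A) :=
  range (fun a : A => [set a + x | x in I]).

(** The number of residue classes modulo [I] ([0] if there are infinitely many). *)
Definition ideal_norm (A : comPzRingType) (I : set A) : nat :=
  #|` fset_set (cosets I) |.

(** [pi : A -> B] exhibits [B] as [A / I]. *)
Definition is_quotient (A B : comPzRingType) (pi : {rmorphism A -> B})
    (I : set A) : Prop :=
  (forall b : B, exists a : A, pi a = b) /\ (forall a : A, pi a = 0 <-> I a).

(** [b : A -> B] exhibits [B] as [A[1/s]]. *)
Definition is_localization (A B : comPzRingType) (s : A)
    (b : {rmorphism A -> B}) : Prop :=
  [/\ (exists t : B, b s * t = 1),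
      (forall y : B, exists (a : A) (n : nat), y * b s ^+ n = b a) &
      (forall a : A, b a = 0 -> exists n : nat, s ^+ n * a = 0)].

(** [(j, X)] exhibits [P] as the polynomial ring over [A] in [n] variables. *)
Definition is_polynomial_ring (A P : comPzRingType) (n : nat)
    (j : {rmorphism A -> P}) (X : 'I_n -> P) : Prop :=
  forall (C : comPzRingType) (f : {rmorphism A -> C}) (c : 'I_n -> C),
    exists g : {rmorphism P -> C},
      [/\ g \o j =1 f, (forall i, g (X i) = c i) &
          forall h : {rmorphism P -> C},
            h \o j =1 f -> (forall i, h (X i) = c i) -> h =1 g].

Definition fin_type_alg (A B : comPzRingType) (f : {rmorphism A -> B}) : Prop :=
  exists (n : nat) (P : comPzRingType) (j : {rmorphism A -> P}) (X : 'I_n -> P)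
         (q : {rmorphism P -> B}),
    [/\ is_polynomial_ring j X, q \o j =1 f &
        forall b : B, exists a : P, q a = b].

Definition fin_pres_alg (A B : comPzRingType) (f : {rmorphism A -> B}) : Prop :=
  exists (n : nat) (P : comPzRingType) (j : {rmorphism A -> P}) (X : 'I_n -> P)
         (q : {rmorphism P -> B}) (k : nat) (g : 'I_k -> P),
    [/\ is_polynomial_ring j X, q \o j =1 f &
        is_quotient q (ideal_gen (range g))].

(** There are primes [p 0 < p 1 < ... < p n] of [A], i.e. the Krull dimension
    of [A] is at least [n]. *)
Definition prime_chain (A : comPzRingType) (n : nat) : Prop :=
  exists p : nat -> set A,
    (forall i, (i <= n)%N -> is_prime_ideal (p i)) /\
    (forall i, (i < n)%N -> p i `<` p i.+1).

(** Schemes are defined through their functors of points, as in Demazure-Gabriel: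
  a scheme is a functor from commutative rings to sets which is a sheaf for the
  Zariski topology and is covered by open subfunctors representable by rings.
  The zero ring is among the test rings. *)

Record zfunctor := Zfunctor {
  zpt :> comPzRingType -> Type;
  zmap : forall A B : comPzRingType, {rmorphism A -> B} -> zpt A -> zpt B;
  zmap_id : forall (A : comPzRingType) (f : {rmorphism A -> A}) (x : zpt A),
    f =1 id -> zmap f x = x;
  zmap_comp : forall (A B C : comPzRingType) (f : {rmorphism A -> B})
      (g : {rmorphism B -> C}) (h : {rmorphism A -> C}) (x : zpt A),
    h =1 g \o f -> zmap h x = zmap g (zmap f x) }.

(** A functor with a morphism to [Spec A], i.e. to [B |-> Hom(A, B)]. *)
Record zfunctor_over (A : comPzRingType) := ZfunctorOver {
  zfun :> zfunctor;
  zstr : forall B : comPzRingType, zfun B -> {rmorphism A -> B};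
  zstr_nat : forall (B C : comPzRingType) (f : {rmorphism B -> C}) (x : zfun B),
    zstr (zmap f x) =1 f \o zstr x }.

Record zmor (F G : zfunctor) := Zmor {
  zmor_fun :> forall B : comPzRingType, F B -> G B;
  zmor_nat : forall (B C : comPzRingType) (f : {rmorphism B -> C}) (x : F B),
    zmor_fun (zmap f x) = zmap f (zmor_fun x) }.

Definition over_base (A : comPzRingType) (F G : zfunctor_over A)
    (h : zmor F G) : Prop :=
  forall (B : comPzRingType) (x : F B), zstr (h B x) =1 zstr x.

Definition zmor_iso (F G : zfunctor) (h : zmor F G) : Prop :=
  forall B : comPzRingType, bijective (h B).

(** [x : F A], seen as a morphism [Spec A -> F], pulls an open subfunctor [U]
    back to the complement of [V(E)] in [Spec A]; a ring map [A -> B] factors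
    through that complement iff [E] generates the unit ideal of [B]. *)
Definition is_open (F : zfunctor)
    (U : forall B : comPzRingType, set (F B)) : Prop :=
  forall (A : comPzRingType) (x : F A), exists E : set A,
    forall (B : comPzRingType) (f : {rmorphism A -> B}),
      U B (zmap f x) <-> ideal_gen (f @` E) 1.

(** [U] is an open subfunctor represented by [A], with universal point [u]. *)
Definition is_affine_open (F : zfunctor)
    (U : forall B : comPzRingType, set (F B)) (A : comPzRingType) (u : F A) :
    Prop :=
  [/\ is_open U, U A u &
      forall (B : comPzRingType) (y : F B), U B y ->
        exists f : {rmorphism A -> B}, zmap f u = y /\
          forall g : {rmorphism A -> B}, zmap g u = y -> g =1 f].

Definition zariski_sheaf (F : zfunctor) : Prop :=
  forall (A : comPzRingType) (n : nat) (s : 'I_n -> A),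
    ideal_gen (range s) 1 ->
  forall (B : 'I_n -> comPzRingType) (b : forall i, {rmorphism A -> B i})
    (C : 'I_n -> 'I_n -> comPzRingType)
    (c : forall i j, {rmorphism A -> C i j})
    (l : forall i j, {rmorphism B i -> C i j})
    (r : forall i j, {rmorphism B j -> C i j}),
    (forall i, is_localization (s i) (b i)) ->
    (forall i j, is_localization (s i * s j) (c i j)) ->
    (forall i j, l i j \o b i =1 c i j) ->
    (forall i j, r i j \o b j =1 c i j) ->
  forall x : forall i, F (B i),
    (forall i j, zmap (l i j) (x i) = zmap (r i j) (x j)) ->
    exists! y : F A, forall i, zmap (b i) y = x i.

(** A family of open subfunctors covers when it does so on field-valued
    points. *)
Definition is_scheme (F : zfunctor) : Prop :=
  zariski_sheaf F /\
  forall (k : fieldType) (x : F k),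
    exists (U : forall B : comPzRingType, set (F B)) (A : comPzRingType)
           (u : F A),
      is_affine_open U u /\ U k x.

Lemma rmorph_ext (A B : comPzRingType) (f g : {rmorphism A -> B}) :
  f =1 g -> f = g.
Proof.
move=> fg; have {fg} : GRing.RMorphism.sort f = GRing.RMorphism.sort g.
  exact/funext.
case: f g => [f [f1 f2]] [g [g1 g2]] /= fg; subst g.
by case: f1 g1 => f1 [g1]; case: f2 g2 => f2 [g2]; do 2 f_equal;
  f_equal; exact: Prop_irrelevance.
Qed.

Definition bc_pt (A A' : comPzRingType) (phi : {rmorphism A -> A'})
    (F : zfunctor_over A) (B : comPzRingType) : Type :=
  {p : F B * {rmorphism A' -> B} | zstr p.1 =1 p.2 \o phi}.

Lemma bc_map_subproof (A A' : comPzRingType) (phi : {rmorphism A -> A'})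
    (F : zfunctor_over A) (B C : comPzRingType) (f : {rmorphism B -> C})
    (p : bc_pt phi F B) :
  zstr (zmap f (sval p).1) =1 (f \o (sval p).2) \o phi.
Proof. by move=> a; rewrite zstr_nat /= (svalP p a). Qed.

Definition bc_map (A A' : comPzRingType) (phi : {rmorphism A -> A'})
    (F : zfunctor_over A) (B C : comPzRingType) (f : {rmorphism B -> C})
    (p : bc_pt phi F B) : bc_pt phi F C :=
  exist (fun p : F C * {rmorphism A' -> C} => zstr p.1 =1 p.2 \o phi)
    (zmap f (sval p).1, GRing.RMorphism.clone _ _ (f \o (sval p).2) _)
    (bc_map_subproof f p).

Lemma bc_map_id (A A' : comPzRingType) (phi : {rmorphism A -> A'})
    (F : zfunctor_over A) (B : comPzRingType) (f : {rmorphism B -> B})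
    (x : bc_pt phi F B) :
  f =1 id -> bc_map f x = x.
Proof.
case: x => [[x g] xg] fid; apply: eq_exist; congr pair; first exact: zmap_id.
by apply: rmorph_ext => a /=; rewrite fid.
Qed.

Lemma bc_map_comp (A A' : comPzRingType) (phi : {rmorphism A -> A'})
    (F : zfunctor_over A) (B C D : comPzRingType) (f : {rmorphism B -> C})
    (g : {rmorphism C -> D}) (h : {rmorphism B -> D}) (x : bc_pt phi F B) :
  h =1 g \o f -> bc_map h x = bc_map g (bc_map f x).
Proof.
case: x => [[x k] xk] hgf; apply: eq_exist; congr pair; first exact: zmap_comp.
by apply: rmorph_ext => a /=; rewrite hgf.
Qed.

Definition base_change (A A' : comPzRingType) (phi : {rmorphism A -> A'})
    (F : zfunctor_over A) : zfunctor_over A' :=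
  @ZfunctorOver A' (Zfunctor (@bc_map_id A A' phi F) (@bc_map_comp A A' phi F))
    (fun B (x : bc_pt phi F B) => (sval x).2)
    (fun B C f x => fun=> erefl).

(** The diagonal is a closed immersion: the locus where two points [x], [y]
    over the base coincide is the closed subscheme [V(E)] of [Spec B]. *)
Definition is_separated (A : comPzRingType) (F : zfunctor_over A) : Prop :=
  forall (B : comPzRingType) (x y : F B), zstr x =1 zstr y ->
    exists E : set B, forall (C : comPzRingType) (f : {rmorphism B -> C}),
      zmap f x = zmap f y <-> (forall e, E e -> f e = 0).

Definition of_finite_type (A : comPzRingType) (F : zfunctor_over A) : Prop :=
  exists (n : nat) (U : 'I_n -> forall B : comPzRingType, set (F B))
         (R : 'I_n -> comPzRingType) (u : forall i, F (R i)),
    (forall i, is_affine_open (U i) (u i) /\ fin_type_alg (zstr (u i))) /\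
    (forall (k : fieldType) (x : F k), exists i, U i k x).

(** After any base change [Spec A' -> Spec A], the image in [Spec A'] of the
    complement of an open [U] is a closed set [V(E)]. A point of [Spec A'] is
    given by a map [psi] to a field [k]; it is hit iff it lifts over some
    extension [k'] of [k]. *)
Definition universally_closed (A : comPzRingType) (F : zfunctor_over A) :
    Prop :=
  forall (A' : comPzRingType) (phi : {rmorphism A -> A'})
    (U : forall B : comPzRingType, set (base_change phi F B)),
    is_open U ->
    exists E : set A', forall (k : fieldType) (psi : {rmorphism A' -> k}),
      (exists (k' : fieldType) (j : {rmorphism k -> k'})
              (x : base_change phi F k'),
         zstr x =1 j \o psi /\ ~ U k' x)
      <-> (forall e, E e -> psi e = 0).

Definition is_proper (A : comPzRingType) (F : zfunctor_over A) : Prop :=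
  [/\ of_finite_type F, is_separated F & universally_closed F].

Definition loc_fin_pres (A : comPzRingType) (F : zfunctor_over A) : Prop :=
  forall (k : fieldType) (x : F k),
    exists (U : forall B : comPzRingType, set (F B)) (R : comPzRingType)
           (u : F R),
      [/\ is_affine_open U u, fin_pres_alg (zstr u) & U k x].

Definition formally_smooth (A : comPzRingType) (F : zfunctor_over A) : Prop :=
  forall (B C : comPzRingType) (pi : {rmorphism B -> C})
    (phi : {rmorphism A -> B}) (x : F C),
    (forall c : C, exists b : B, pi b = c) ->
    (forall a b : B, pi a = 0 -> pi b = 0 -> a * b = 0) ->
    zstr x =1 pi \o phi ->
    exists2 y : F B, zmap pi y = x & zstr y =1 phi.

Definition is_smooth (A : comPzRingType) (F : zfunctor_over A) : Prop :=
  loc_fin_pres F /\ formally_smooth F.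

Definition row_space (B : comPzRingType) (n : nat) (e : 'M[B]_n) :
    set 'rV[B]_n :=
  range (fun v : 'rV[B]_n => v *m e).

(** The direct summands of rank [1] of [B^n]: the images of the idempotent
    matrices which have rank [1] at every point of [Spec B], i.e. vanishing
    [2 x 2] minors and trace [1]. *)
Definition is_line (B : comPzRingType) (n : nat) (L : set 'rV[B]_n) : Prop :=
  exists e : 'M[B]_n,
    [/\ e *m e = e, \tr e = 1,
        (forall i j k l, e i k * e j l = e i l * e j k) & L = row_space e].

Definition lin_span (B : comPzRingType) (n : nat) (V : set 'rV[B]_n) :
    set 'rV[B]_n :=
  [set v | exists (k : nat) (a : 'rV[B]_k) (M : 'M[B]_(k, n)),
             (forall i, V (row i M)) /\ v = a *m M].

Lemma lin_span_row_space (B C : comPzRingType) (n : nat)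
    (f : {rmorphism B -> C}) (e : 'M[B]_n) :
  lin_span (map_mx f @` row_space e) = row_space (map_mx f e).
Proof.
apply/seteqP; split=> [v [k [a [M [VM ->]]]]|v [w _ <-]].
  have /choice[W HW] i : exists w, w *m map_mx f e = row i M.
    have [_ [u _ <-] <-] := VM i; exists (map_mx f u).
    by rewrite map_mxM.
  exists (a *m \matrix_i W i) => //=; rewrite -mulmxA; congr (_ *m _).
  by apply/row_matrixP => i; rewrite row_mul rowK HW.
exists n, w, (map_mx f e); split=> // i.
exists (row i e); last by apply/rowP => j; rewrite !mxE.
by exists (delta_mx 0 i) => //; rewrite -rowE.
Qed.

Definition proj_pt (n : nat) (B : comPzRingType) : Type :=
  {L : set 'rV[B]_n.+1 | is_line L}.

Lemma proj_map_subproof (n : nat) (B C : comPzRingType)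
    (f : {rmorphism B -> C}) (L : proj_pt n B) :
  is_line (lin_span (map_mx f @` sval L)).
Proof.
case: L => /= L [e [ee te me ->]]; rewrite lin_span_row_space.
exists (map_mx f e); split=> //.
- by rewrite -map_mxM ee.
- by rewrite trace_map_mx te rmorph1.
- by move=> i j k l; rewrite !mxE -!rmorphM me.
Qed.

(** The [C]-submodule generated by the image of [L], i.e. the image of
    [L (x)_B C]. *)
Definition proj_map (n : nat) (B C : comPzRingType) (f : {rmorphism B -> C})
    (L : proj_pt n B) : proj_pt n C :=
  exist _ _ (proj_map_subproof f L).

Lemma proj_map_id (n : nat) (B : comPzRingType) (f : {rmorphism B -> B})
    (L : proj_pt n B) :
  f =1 id -> proj_map f L = L.
Proof.
case: L => L [e [ee te me eL]] fid; apply: eq_exist => /=.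
rewrite eL lin_span_row_space; congr row_space.
by apply/matrixP => i j; rewrite mxE fid.
Qed.

Lemma proj_map_comp (n : nat) (B C D : comPzRingType) (f : {rmorphism B -> C})
    (g : {rmorphism C -> D}) (h : {rmorphism B -> D}) (L : proj_pt n B) :
  h =1 g \o f -> proj_map h L = proj_map g (proj_map f L).
Proof.
case: L => L [e [ee te me eL]] hgf; apply: eq_exist => /=.
rewrite eL !lin_span_row_space; congr row_space.
by apply/matrixP => i j; rewrite !mxE hgf.
Qed.

Definition proj_space (n : nat) : zfunctor :=
  Zfunctor (@proj_map_id n) (@proj_map_comp n).

(** [F] is a closed subscheme, via [h] and the structure map, of projective
    [n]-space over [A] for some [n]. *)
Definition is_projective (A : comPzRingType) (F : zfunctor_over A) : Prop :=
  exists (n : nat) (h : zmor F (proj_space n)),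
    (forall (B : comPzRingType) (x y : F B),
       h B x = h B y -> zstr x =1 zstr y -> x = y) /\
    (forall (B : comPzRingType) (y : proj_space n B) (phi : {rmorphism A -> B}),
       exists E : set B, forall (C : comPzRingType) (f : {rmorphism B -> C}),
         (exists2 x : F C, h C x = zmap f y & zstr x =1 f \o phi)
         <-> (forall e, E e -> f e = 0)).

Definition nonempty_sub (F : zfunctor)
    (U : forall B : comPzRingType, set (F B)) : Prop :=
  exists (k : fieldType) (x : F k), U k x.

Definition irreducible_scheme (F : zfunctor) : Prop :=
  nonempty_sub (fun B => [set: F B]) /\
  forall U V : (forall B : comPzRingType, set (F B)),
    is_open U -> is_open V -> nonempty_sub U -> nonempty_sub V ->
    nonempty_sub (fun B => U B `&` V B).

Definition reduced_scheme (F : zfunctor) : Prop :=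
  forall (U : forall B : comPzRingType, set (F B)) (R : comPzRingType)
    (u : F R), is_affine_open U u ->
    forall a : R, a * a = 0 -> a = 0.

Definition has_dimension (F : zfunctor) (d : nat) : Prop :=
  (exists (U : forall B : comPzRingType, set (F B)) (R : comPzRingType)
          (u : F R), is_affine_open U u /\ prime_chain R d) /\
  (forall (U : forall B : comPzRingType, set (F B)) (R : comPzRingType)
          (u : F R), is_affine_open U u -> ~ prime_chain R d.+1).

Definition smooth_projective_curve (K : fieldType) (X : zfunctor_over K) :
    Prop :=
  [/\ is_scheme X, is_smooth X, is_projective X,
      (irreducible_scheme X /\ reduced_scheme X) & has_dimension X 1].

Definition rat_pt (K : fieldType) (X : zfunctor_over K) : Type :=
  {x : X K | zstr x =1 id}.

Definition int_pred (K : fieldExtType rat) : {pred K} :=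
  [pred x | `[< integralOver (intr : int -> K) x >]].
Arguments int_pred K : clear implicits.

Lemma int_subring (K : fieldExtType rat) : subring_closed (int_pred K).
Proof.
split=> [|x y /asboolP xi /asboolP yi|x y /asboolP xi /asboolP yi].
- exact/asboolP/integral1.
- exact/asboolP/integral_sub.
- exact/asboolP/integral_mul.
Qed.

HB.instance Definition _ (K : fieldExtType rat) :=
  GRing.isSubringClosed.Build K (int_pred K) (@int_subring K).

Record integers (K : fieldExtType rat) := Integers {
  int_val : K;
  _ : int_val \in int_pred K }.

HB.instance Definition _ (K : fieldExtType rat) :=
  [isSub for @int_val K].
HB.instance Definition _ (K : fieldExtType rat) :=
  [Choice of integers K by <:].
HB.instance Definition _ (K : fieldExtType rat) :=
  [SubChoice_isSubComNzRing of integers K by <:].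

Record finite_place (K : fieldExtType rat) := FinitePlace {
  fp_ideal : set (integers K);
  fp_prime : is_prime_ideal fp_ideal;
  fp_nonzero : exists2 a, fp_ideal a & a <> 0 }.

HB.instance Definition _ (K : fieldExtType rat) :=
  gen_eqMixin (finite_place K).
HB.instance Definition _ (K : fieldExtType rat) :=
  gen_choiceMixin (finite_place K).

(** The absolute values induced by the complex embeddings; conjugate
    embeddings give the same place. Embeddings of [K] land in [algC]. *)
Record infinite_place (K : fieldExtType rat) := InfinitePlace {
  ip_abs : K -> algC;
  ip_absP : exists sigma : {rmorphism K -> algC},
              forall x, ip_abs x = `|sigma x| }.

Inductive place (K : fieldExtType rat) :=
  | FinPlace of finite_place K
  | InfPlace of infinite_place K.

(** The [x] which are integral at every finite place outside [S], i.e. lie in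
    the localization of the ring of integers at each such prime. *)
Definition sint_pred (K : fieldExtType rat) (S : set (place K)) : {pred K} :=
  [pred x | `[< forall nu : finite_place K, ~ S (FinPlace nu) ->
                exists a b : integers K,
                  ~ fp_ideal nu b /\ x * int_val b = int_val a >]].

Lemma sint_subring (K : fieldExtType rat) (S : set (place K)) :
  subring_closed (sint_pred S).
Proof.
have prM (nu : finite_place K) (b d : integers K) :
    ~ fp_ideal nu b -> ~ fp_ideal nu d -> ~ fp_ideal nu (b * d).
  by have [_ _ pP] := fp_prime nu => nb nd /pP[].
split=> [|x y /asboolP xi /asboolP yi|x y /asboolP xi /asboolP yi];
  apply/asboolP => nu nuS.
- exists 1, 1; split; first by have [] := fp_prime nu.
  by rewrite mul1r.
- have [a [b [nb xb]]] := xi nu nuS; have [c [d [nd yd]]] := yi nu nuS.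
  exists (a * d - c * b), (b * d); split; first exact: prM.
  have -> : int_val (a * d - c * b) =
      int_val a * int_val d - int_val c * int_val b by [].
  have -> : int_val (b * d) = int_val b * int_val d by [].
  by rewrite -xb -yd mulrBl !mulrA; congr (_ - _); rewrite mulrAC.
- have [a [b [nb xb]]] := xi nu nuS; have [c [d [nd yd]]] := yi nu nuS.
  exists (a * c), (b * d); split; first exact: prM.
  have -> : int_val (a * c) = int_val a * int_val c by [].
  have -> : int_val (b * d) = int_val b * int_val d by [].
  by rewrite -xb -yd mulrACA.
Qed.

HB.instance Definition _ (K : fieldExtType rat) (S : set (place K)) :=
  GRing.isSubringClosed.Build K (sint_pred S) (@sint_subring K S).

Record sintegers (K : fieldExtType rat) (S : set (place K)) := Sintegers {
  sint_val : K;
  _ : sint_val \in sint_pred S }.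

HB.instance Definition _ (K : fieldExtType rat) (S : set (place K)) :=
  [isSub for @sint_val K S].
HB.instance Definition _ (K : fieldExtType rat) (S : set (place K)) :=
  [Choice of sintegers S by <:].
HB.instance Definition _ (K : fieldExtType rat) (S : set (place K)) :=
  [SubChoice_isSubComNzRing of sintegers S by <:].

Definition sint_incl (K : fieldExtType rat) (S : set (place K)) :
    {rmorphism sintegers S -> K} :=
  GRing.RMorphism.clone _ _ (val : sintegers S -> K) _.

(** The extension to the [S]-integers of the prime ideal of the place [nu]. *)
Definition sprime (K : fieldExtType rat) (S : set (place K))
    (nu : finite_place K) : set (sintegers S) :=
  ideal_gen [set x | exists2 a : integers K,
                       fp_ideal nu a & sint_val x = int_val a].

Inductive multiplicity := Mfin of nat | Minf.

Record mcurve (K : fieldType) := Mcurve {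
  mc_curve :> zfunctor_over K;
  mc_curveP : smooth_projective_curve mc_curve;
  mc_mult : rat_pt mc_curve -> multiplicity;
  mc_mult_gt0 : forall P n, mc_mult P = Mfin n -> (0 < n)%N;
  mc_mult_fin : finite_set [set P | mc_mult P <> Mfin 1] }.

Record smooth_proper_model (K : fieldExtType rat) (S : set (place K))
    (X : zfunctor_over K) := SmoothProperModel {
  spm_total :> zfunctor_over (sintegers S);
  spm_scheme : is_scheme spm_total;
  spm_smooth : is_smooth spm_total;
  spm_proper : is_proper spm_total;
  spm_generic : zmor X (base_change (sint_incl S) spm_total);
  spm_generic_over : over_base spm_generic;
  spm_generic_iso : zmor_iso spm_generic }.

(** The [S]-integers for [S] the set of all places but [nu] are the local ring
    of the ring of integers at [nu]. *)
Definition bad_reduction (K : fieldExtType rat) (X : zfunctor_over K)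
    (nu : finite_place K) : Prop :=
  ~ inhabited (smooth_proper_model (~` [set FinPlace nu]) X).

(** [x] is the section of the model over the [S]-integers which extends the
    [K]-point [P] (unique, and existing, by properness). *)
Definition extends_pt (K : fieldExtType rat) (S : set (place K))
    (X : zfunctor_over K) (M : smooth_proper_model S X) (P : rat_pt X)
    (x : M (sintegers S)) : Prop :=
  zstr x =1 id /\
  zmap (sint_incl S) x = (sval (spm_generic M K (sval P))).1.

Definition coincide (K : fieldExtType rat) (S : set (place K))
    (X : zfunctor_over K) (M : smooth_proper_model S X) (nu : finite_place K)
    (P Q : rat_pt X) (m : nat) : Prop :=
  exists (x y : M (sintegers S)) (B : comPzRingType)
         (pi : {rmorphism sintegers S -> B}),
    [/\ extends_pt P x, extends_pt Q y,
        is_quotient pi (ideal_pow (@sprime K S nu) m) &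
        zmap pi x = zmap pi y].

(** Meant for [P <> Q] and [nu] outside [S]. *)
Definition intersection_mult (K : fieldExtType rat) (S : set (place K))
    (X : zfunctor_over K) (M : smooth_proper_model S X) (nu : finite_place K)
    (P Q : rat_pt X) : nat :=
  xget 0%N [set m | coincide M nu P Q m /\
                    forall n, coincide M nu P Q n -> (n <= m)%N].

(** Meant for [t <> P], so that almost all factors are [1]. *)
Definition lambda (K : fieldExtType rat) (S : set (place K))
    (X : zfunctor_over K) (M : smooth_proper_model S X) (P t : rat_pt X) :
    nat :=
  (\big[muln/1%N]_(nu \in [set nu | ~ S (FinPlace nu)])
     ideal_norm (@sprime K S nu) ^ intersection_mult M nu t P)%N.

Definition free_part (m n : nat) : nat :=
  (n %/ \max_(d < n.+1 | d ^ m %| n) d ^ m)%N.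

(** For infinite multiplicity only the power [1] is divided out. *)
Definition H_part (K : fieldExtType rat) (S : set (place K)) (X : mcurve K)
    (M : smooth_proper_model S X) (P t : rat_pt X) : nat :=
  match mc_mult P with
  | Mfin m => if m == 1%N then 1%N else free_part m (lambda M P t)
  | Minf => lambda M P t
  end.

(** [k = 0 mod m], where [k = 0 mod oo] means [k = 0]. *)
Definition congr0_mod (k : nat) (m : multiplicity) : Prop :=
  match m with
  | Mfin n => (n %| k)%N
  | Minf => k = 0%N
  end.

(** [(t . t)] is infinite, hence imposes no condition for [P = t]. *)
Definition integral_points (K : fieldExtType rat) (S : set (place K))
    (X : mcurve K) (M : smooth_proper_model S X) : set (rat_pt X) :=
  [set t | forall P : rat_pt X, P <> t -> forall nu : finite_place K,
             ~ S (FinPlace nu) ->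
             congr0_mod (intersection_mult M nu t P) (mc_mult P)].

(** As [H_part M P t] makes sense for [t <> P] only, [t = P] is subject to no
    condition, in accordance with the convention for [integral_points]. *)
Definition H_trivial_points (K : fieldExtType rat) (S : set (place K))
    (X : mcurve K) (M : smooth_proper_model S X) (P : rat_pt X) :
    set (rat_pt X) :=
  [set t | t <> P -> H_part M P t = 1%N].

Definition mult_gt1 (m : multiplicity) : Prop :=
  match m with
  | Mfin n => (1 < n)%N
  | Minf => True
  end.

(* Main.v *)
(** If [m] divides all intersection numbers [(t . P)_nu], then [lambda] is the
  [m]-th power of a product of residue norms, so its [m]-free part is [1]; the
  norms are nonzero because [d + 1] elements of a number field of degree [d]
  satisfy an integral relation whose coefficients are not all divisible by [p],
  which bounds the dimension over [F_p] of the residue ring.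

  Over [Q] the norm of the place [nu] is the prime [p] below it, and [nu] is
  determined by [p]. Distinct sections of a separated model agree at finitely
  many places only, so [(t . P)_nu] is the [p]-adic valuation of [lambda], and
  it is divisible by [m] as soon as [lambda] is an [m]-th power. *)
Require Import Defs.
From mathcomp Require Import all_boot all_order all_algebra all_field finmap.
From mathcomp Require Import boolp classical_sets functions cardinality fsbigop.
Set Implicit Arguments.
Unset Strict Implicit.
Unset Printing Implicit Defensive.
Import GRing.Theory.
Local Open Scope classical_set_scope.
Local Open Scope ring_scope.

(** * Ideals and the rational integers they contain *)

Lemma Bezout_prime (p : nat) (z : int) : prime p -> ~~ (p %| z)%Z ->
  exists u v : int, u * z + v * p%:Z = 1.
Proof.
move=> pp pz; have [u [v uv]] := Bezoutz z p; exists u, v; rewrite uv.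
by apply/eqP; move: pz; rewrite /dvdz -prime_coprime // coprime_sym.
Qed.

Lemma absz_modz_lt (z : int) (n : nat) : (0 < n)%N -> (`|(z %% n)%Z| < n)%N.
Proof.
move=> n0; rewrite -ltz_nat gez0_abs ?ltz_pmod // modz_ge0 //.
by rewrite -lt0n.
Qed.

Section Ideals.
Variables (A : comPzRingType) (I : set A).
Hypothesis Iideal : is_ideal I.

Lemma ideal0 : I 0. Proof. by have [] := Iideal. Qed.

Lemma idealD x y : I x -> I y -> I (x + y).
Proof. by have [_ + _] := Iideal; apply. Qed.

Lemma idealMl a x : I x -> I (a * x).
Proof. by have [_ _] := Iideal; apply. Qed.

Lemma idealMr a x : I x -> I (x * a).
Proof. by rewrite mulrC; apply: idealMl. Qed.

Lemma idealN x : I x -> I (- x).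
Proof. by rewrite -mulN1r; apply: idealMl. Qed.

Lemma idealB x y : I x -> I y -> I (x - y).
Proof. by move=> Ix Iy; apply/idealD/idealN. Qed.

Lemma idealMz x (z : int) : I x -> I (x *~ z).
Proof. by move=> Ix; rewrite -mulrzr; apply: idealMr. Qed.

Lemma ideal_sum n (x : 'I_n -> A) : (forall i, I (x i)) -> I (\sum_i x i).
Proof. by move=> Ix; elim/big_ind: _ => //; [exact: ideal0|exact: idealD]. Qed.

Lemma eq_coset (a b : A) :
  [set a + x | x in I] = [set b + x | x in I] <-> I (a - b).
Proof.
split=> [ab|Iab].
  have : [set a + x | x in I] a by exists 0; [exact: ideal0|rewrite addr0].
  by rewrite ab => -[x Ix <-]; rewrite addrC addKr.
apply/seteqP; split=> _ [x Ix <-].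
  by exists (a - b + x); [exact: idealD|rewrite addrA addrCA subrr addr0].
exists (x - (a - b)); first exact: idealB.
by rewrite opprB addrC -addrA subrK addrC.
Qed.

(** An integer of [I] not divisible by $p$ would, by a Bezout relation with $p$, put $1$ in [I]. *)
Lemma ideal_int (p : nat) : prime p -> ~ I 1 -> I p%:R -> forall z : int,
  I z%:~R <-> (p %| z)%Z.
Proof.
move=> pp I1 Ip z; split=> [Iz|/dvdzP[q ->]].
  apply/negPn/negP => pz; apply: I1.
  have [u [v /(congr1 (fun z : int => z%:~R : A))]] := Bezout_prime pp pz.
  by rewrite intrD !intrM mulr1z => <-; apply: idealD; apply: idealMl.
by rewrite rmorphM; apply: idealMl.
Qed.

End Ideals.

(** Strong induction: splitting off the least prime factor, primality puts it or the smaller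
    cofactor in [I]. *)
Lemma prime_ideal_nat (A : comPzRingType) (I : set A) (n : nat) :
  is_prime_ideal I -> (0 < n)%N -> I n%:R -> exists2 p, prime p & I p%:R.
Proof.
move=> [Iid I1 IM]; elim/ltn_ind: n => n IHn n0 In.
have [n1|n1] := leqP n 1; first by case: n n0 n1 In {IHn} => [|[]].
move: In; rewrite -(divnK (pdiv_dvd n)) natrM => /IM[In|In].
  apply: IHn In; first by rewrite ltn_Pdiv // prime_gt1 ?pdiv_prime.
  by rewrite divn_gt0 ?pdiv_gt0 // dvdn_leq ?pdiv_dvd.
by exists (pdiv n) => //; exact: pdiv_prime.
Qed.

(* Clearing denominators and dividing by the gcd makes the coefficients of a
   linear relation coprime. *)
Lemma primitive_relation (V : vectType rat) (n p : nat) (x : 'I_n -> V) :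
  (1 < p)%N -> (\dim {:V} < n)%N ->
  exists c : 'I_n -> int,
    \sum_i x i *~ c i = 0 /\ exists i, ~~ (p %| c i)%Z.
Proof.
move=> p1 Vn.
have : ~~ free [tuple x i | i < n].
  apply: contraL Vn => /eqP; rewrite size_tuple -leqNgt => <-.
  exact/dimvS/subvf.
move/freeP/existsNP => [k /not_implyP[xk /existsNP[i0 ki0]]].
pose D : int := \prod_i denq (k i).
have D0 : D != 0 by apply/prodf_neq0 => i _; apply: denq_neq0.
(* [c i] is $k_i D$ as an integer: the denominator of [k i] in [D] is replaced by its numerator. *)
pose c i : int := numq (k i) * \prod_(j | j != i) denq (k j).
have cE i : (c i)%:~R = k i * D%:~R :> rat.
  rewrite /D (bigD1 i) //= /c !intrM mulrA; congr (_ * _).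
  by rewrite -{2}[k i]divq_num_den mulfVK ?intr_eq0 ?denq_neq0.
pose g := \big[gcdn/0%N]_i `|c i|%N.
have gc i : (g %| c i)%Z by rewrite /dvdz /=; apply: biggcdn_inf.
have ci0 : c i0 != 0.
  rewrite -(intr_eq0 rat) cE mulf_neq0 ?intr_eq0 //; exact/eqP.
have g0 : g%:Z != 0.
  by apply: contraNneq ci0 => g0; have := gc i0; rewrite g0 dvd0z.
exists (fun i => (c i %/ g)%Z); split.
  have /eqP : g%:~R *: (\sum_i x i *~ (c i %/ g)%Z) = 0 :> V.
    transitivity (D%:~R *: \sum_i k i *: [tuple x i | i < n]`_i); last first.
      by rewrite xk scaler0.
    rewrite !scaler_sumr.
    apply: eq_bigr => i _; rewrite (nth_map i) ?size_enum_ord // nth_ord_enum.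
    by rewrite -scaler_int !scalerA -intrM [g%:Z * _]mulrC divzK // cE mulrC.
  by rewrite scaler_eq0 intr_eq0 (negPf g0) => /eqP.
(* If $p$ divided every $c_i/g$, then $pg$ would divide the gcd $g \neq 0$, impossible for $p>1$. *)
apply: contrapT => /forallNP pc.
have /dvdn_leq : (p * g %| g)%N.
  rewrite {2}/g; apply/dvdn_biggcdP => i _.
  have /negP/negPn/dvdzP[q] := pc i.
  by rewrite -{2}(divzK (gc i)) => ->; rewrite abszM abszM -mulnA dvdn_mull.
move/(_ _); rewrite lt0n => /(_ g0); rewrite leqNgt ltn_Pmull //.
by rewrite lt0n.
Qed.

(** * Residue rings: finiteness, and their size in degree one *)

Section Residues.
Variables (K : fieldExtType rat) (A : comPzRingType) (f : {rmorphism A -> K}).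
Variables (I : set A) (p : nat).
Hypotheses (f_inj : injective f) (Iideal : is_ideal I).
Hypotheses (p_prime : prime p) (Ip : I p%:R).

Lemma ring_relation n (x : 'I_n -> A) : (\dim {:K} < n)%N ->
  exists c : 'I_n -> int,
    \sum_i x i *~ c i = 0 /\ exists i, ~~ (p %| c i)%Z.
Proof.
move=> Kn.
have [c [c0 pc]] := @primitive_relation K n p (f \o x) (prime_gt1 p_prime) Kn.
exists c; split=> //; apply: f_inj; rewrite rmorph0 -c0 rmorph_sum.
by apply: eq_bigr => i _; rewrite rmorphMz.
Qed.

(** Linear independence over $\mathbb{F}_p$ of the classes in $A/I$, phrased with integer
    coefficients so that no quotient has to be built. *)
Definition indep_mod n (x : 'I_n -> A) : Prop :=
  forall c : 'I_n -> int, I (\sum_i x i *~ c i) -> forall i, (p %| c i)%Z.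

Lemma ideal_dvdz (a : A) (z : int) : (p %| z)%Z -> I (a *~ z).
Proof.
by move=> /dvdzP[q ->]; rewrite mulrzA -mulrzr; apply: idealMl.
Qed.

Lemma ideal_modz (a : A) (z : int) : I (a *~ z - a *+ `|(z %% p)%Z|%N).
Proof.
rewrite pmulrn gez0_abs; last by rewrite modz_ge0 // -lt0n prime_gt0.
rewrite {1}(divz_eq z p) mulrzDr addrK.
exact/ideal_dvdz/dvdz_mull.
Qed.

(** Zero lies in [I], so [ring_relation] rules out independent families longer than the degree of
    $K$. *)
Lemma max_indep : exists n (x : 'I_n -> A), indep_mod x /\
  forall y : 'I_n.+1 -> A, ~ indep_mod y.
Proof.
pose Q n := `[< exists x : 'I_n -> A, indep_mod x >].
have Q0 : exists n, Q n.
  by exists 0%N; apply/asboolP; exists (fun=> 0) => c _ [].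
have Qle n : Q n -> (n <= \dim {:K})%N.
  move=> /asboolP[x xi]; rewrite leqNgt; apply/negP => /(ring_relation x).
  move=> [c [c0 [i]]]; rewrite xi // c0; exact: ideal0.
case: (ex_maxnP Q0 Qle) => n /asboolP[x xi] nmax; exists n, x; split=> // y yi.
by have := nmax n.+1; rewrite ltnn => /(_ _)/notF[]; apply/asboolP; exists y.
Qed.

(** A maximal independent family spans $A/I$, so its combinations with coefficients in $0,\dots,p-1$
    meet every coset. *)
Lemma finite_cosets : finite_set (cosets I).
Proof.
have [n [x [xi xmax]]] := max_indep.
pose g (r : {ffun 'I_n -> 'I_p}) : set A :=
  [set \sum_i x i *+ r i + y | y in I].
apply: (@sub_finite_set _ _ (range g)); last exact/finite_image/finite_finset.
move=> _ [a _ <-].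
(* [y] puts [a] in front of [x]; maximality of [x] makes it dependent. *)
pose y (i : 'I_n.+1) := oapp x a (unlift ord0 i).
have /existsNP[c /not_implyP[Ic /existsNP[j pj]]] := xmax y.
move: Ic; rewrite big_ord_recl /y unlift_none /=.
under eq_bigr do rewrite liftK /=.
set s := \sum_i _ => Ic.
(* Otherwise the term of [a] lies in [I], and independence of [x] makes $p$ divide all
   coefficients. *)
have pc : ~~ (p %| c ord0)%Z.
  apply/negP => pc; apply: pj; have [i ->|->//] := unliftP ord0 j.
  apply: (xi (fun i => c (lift ord0 i))); rewrite -/s.
  have -> : s = a *~ c ord0 + s - a *~ c ord0 by rewrite addrAC subrr add0r.
  by apply: idealB => //; apply: ideal_dvdz.
have [u [v uv]] := Bezout_prime p_prime pc.
have p_gt0 := prime_gt0 p_prime.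
(* Since $u c_0 \equiv 1$ modulo $p$, the relation times $u$ gives $a \equiv \sum z_i x_i$ modulo
   [I]. *)
pose z i : int := - (u * c (lift ord0 i)).
exists [ffun i => Ordinal (absz_modz_lt (z i) p_gt0)] => //.
apply/eq_coset => //.
rewrite -opprB; apply: idealN => //.
have -> : a - \sum_i x i *+ [ffun i => Ordinal (absz_modz_lt (z i) p_gt0)] i =
    (a *~ c ord0 + s) *~ u + a *~ (v * p) +
    \sum_i (x i *~ z i - x i *+ `|(z i %% p)%Z|%N).
  rewrite sumrB; under [X in _ - X]eq_bigr do rewrite ffunE /=.
  rewrite addrA; congr (_ - _).
  have -> : \sum_i x i *~ z i = - (s *~ u).
    rewrite /s mulrz_suml -sumrN; apply: eq_bigr => i _.
    by rewrite /z mulrNz mulrC mulrzA.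
  rewrite mulrzDl -mulrzA addrAC addrK [_ * u]mulrC.
  by rewrite -mulrzDr uv mulr1z.
apply: idealD => //; last by apply: ideal_sum => // i; apply: ideal_modz.
apply: idealD => //; first exact: idealMz.
by apply: ideal_dvdz; apply: dvdz_mull.
Qed.

(** The content is finiteness: [ideal_norm] takes the value $0$ on an infinite quotient. *)
Lemma ideal_norm_gt0 : (0 < ideal_norm I)%N.
Proof.
rewrite /ideal_norm cardfs_gt0; apply/fset0Pn.
exists [set 0 + x | x in I]; rewrite in_fset_set; last exact: finite_cosets.
by rewrite inE; exists 0.
Qed.

Hypotheses (K1 : \dim {:K} = 1%N) (I1 : ~ I 1).

(** Apply [ring_relation] to $a$ and $1$. If $p$ divided the coefficient of $a$, the other
    coefficient would lie in [I], hence be divisible by $p$ too. *)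
Lemma dim1_relation (a : A) : exists c d : int,
  a *~ c = d%:~R /\ ~~ (p %| c)%Z.
Proof.
have [|c [c0 [j pj]]] := @ring_relation 2 (fun i => if i == ord0 then a else 1).
  by rewrite K1.
move: c0; rewrite big_ord_recl big_ord1 /= => /eqP; rewrite addr_eq0 => /eqP c0.
exists (c ord0), (- c (lift ord0 ord0)); split; first by rewrite c0 mulrNz.
apply: contra pj => pc; have [i ->|->//] := unliftP ord0 j.
rewrite ord1; apply/(ideal_int Iideal p_prime I1 Ip).
rewrite -[_%:~R]opprK -c0; apply: idealN => //.
exact: ideal_dvdz.
Qed.

Lemma ideal_norm_dim1 : ideal_norm I = p.
Proof.
rewrite /ideal_norm; apply: card_fset_set.
have -> : cosets I = [set [set n%:R + x | x in I] | n in `I_p].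
  apply/seteqP; split=> _ [a Ha <-]; last by exists a%:R.
  have [c [d [ad pc]]] := dim1_relation a.
  have [u [v uv]] := Bezout_prime p_prime pc.
  (* From $ac=d$ and $uc+vp=1$ follows $a = du + avp \equiv du$ modulo [I]. *)
  exists `|((d * u) %% p)%Z|%N => /=.
    exact/absz_modz_lt/prime_gt0.
  apply/eq_coset => //; rewrite -opprB; apply: idealN => //.
  have -> : a = 1 *~ (d * u) + a *~ (v * p).
    by rewrite mulrzA -ad -mulrzA -mulrzDr [c * u]mulrC uv mulr1z.
  rewrite addrAC; apply: idealD => //; first exact: ideal_modz.
  by apply: ideal_dvdz; apply: dvdz_mull.
apply: inj_card_eq => a b; rewrite !inE /= => ap bp /eq_coset.
move=> /(_ Iideal) Iab.
have : I (a%:Z - b%:Z)%:~R by rewrite rmorphB.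
move/(ideal_int Iideal p_prime I1 Ip).
by rewrite -eqz_mod_dvd !modz_nat eqz_nat !modn_small // => /eqP.
Qed.

End Residues.

Lemma ideal_gen_ideal (A : comPzRingType) (E : set A) : is_ideal (ideal_gen E).
Proof.
split=> [I [] //|x y Ex Ey I Iid EI|a x Ex I Iid EI].
- by apply: idealD => //; [exact: Ex|exact: Ey].
- by apply: idealMl => //; exact: Ex.
Qed.

Lemma sub_ideal_gen (A : comPzRingType) (E : set A) : E `<=` ideal_gen E.
Proof. by move=> x Ex I _; apply. Qed.

Lemma ideal_pow_sub (A : comPzRingType) (I : set A) (n : nat) :
  is_ideal I -> (0 < n)%N -> ideal_pow I n `<=` I.
Proof.
case: n => // n Iid _ x; apply=> // y [a Ia ->].
by rewrite big_ord_recl; apply: idealMr.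
Qed.

(** * Finite places and their extensions to the $S$-integers *)

Definition int_incl (K : fieldExtType rat) : {rmorphism integers K -> K} :=
  GRing.RMorphism.clone _ _ (val : integers K -> K) _.

Lemma int_incl_inj (K : fieldExtType rat) : injective (int_incl K).
Proof. exact: val_inj. Qed.

Lemma sint_incl_inj (K : fieldExtType rat) (S : set (place K)) :
  injective (sint_incl S).
Proof. exact: val_inj. Qed.

(** A nonzero $a$ in the prime is a root of an integer polynomial with nonzero constant term $c$;
    then $c$ is a multiple of $a$, and [prime_ideal_nat] applies to $|c|$. *)
Lemma finite_place_prime (K : fieldExtType rat) (nu : finite_place K) :
  exists2 p, prime p & fp_ideal nu p%:R.
Proof.
have [a nua a0] := fp_nonzero nu; have nuid : is_ideal (fp_ideal nu).
  by have [] := fp_prime nu.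
have /asboolP[q /monic_neq0 q0 qa] := valP a.
(* Dividing out the power of $X$ makes the constant term nonzero; $a \neq 0$ remains a root. *)
have [k [r]] := multiplicity_XsubC q 0; rewrite q0 /= => r0 qE.
move: qa; rewrite qE rmorphM rmorphXn /= map_polyXsubC rootM.
have /negPf-> : ~~ root (('X - ((0 : int)%:~R : K)%:P) ^+ k) (val a).
  rewrite /root hornerE expf_neq0 // !hornerE subr0.
  by apply/eqP => va0; apply: a0; apply: val_inj.
rewrite orbF; elim/poly_ind: r r0 {qE} => [|r c _]; first by rewrite root0.
rewrite /root !hornerE => c0 ra.
have cE : c%:~R = - ((map_poly intr r).[a] * a).
  apply/eqP; rewrite -addr_eq0 -(inj_eq (@int_incl_inj K)) rmorph0 -(eqP ra).
  rewrite rmorphD rmorphM rmorph_int addrC -horner_map -map_poly_comp.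
  rewrite (eq_map_poly (rmorph_int _)).
  rewrite [map_poly _ (_ + _)]rmorphD /= map_polyC rmorphM /= map_polyX.
  by rewrite !hornerE.
apply: (@prime_ideal_nat _ _ `|c|%N); first exact: fp_prime.
  by rewrite absz_gt0.
have : fp_ideal nu c%:~R by rewrite cE; apply: idealN => //; apply: idealMl.
case: (intP c) => // n; rewrite abszN rmorphN => /(idealN nuid).
by rewrite opprK.
Qed.

Section SPrimes.
Variables (K : fieldExtType rat) (S : set (place K)).

Lemma sprime_ideal (nu : finite_place K) : is_ideal (@sprime K S nu).
Proof. exact: ideal_gen_ideal. Qed.

Lemma sprime_nat (nu : finite_place K) (p : nat) :
  fp_ideal nu p%:R -> @sprime K S nu p%:R.
Proof.
move=> nup; apply: sub_ideal_gen; exists p%:R => //.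
by rewrite -[LHS]/(sint_incl S _) -[RHS]/(int_incl K _) !rmorph_nat.
Qed.

(** The fractions with numerator in the prime and denominator outside it form an ideal [L] of the
    $S$-integers containing the generators of [sprime]. *)
Lemma sprime_local (nu : finite_place K) (x : sintegers S) :
  ~ S (FinPlace nu) -> @sprime K S nu x ->
  exists a b : integers K, [/\ fp_ideal nu a, ~ fp_ideal nu b &
    sint_val x * int_val b = int_val a].
Proof.
move=> nuS; have [nuid nu1 nuM] := fp_prime nu.
have nuP b d : ~ fp_ideal nu b -> ~ fp_ideal nu d -> ~ fp_ideal nu (b * d).
  by move=> nb nd /nuM[].
pose L : set (sintegers S) := [set y | exists a b : integers K,
  [/\ fp_ideal nu a, ~ fp_ideal nu b & sint_val y * int_val b = int_val a]].
move=> /(_ L); apply; last first.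
  by move=> y [a nua ya]; exists a, 1; rewrite ya mulr1.
split=> [|y z [a [b [nua nub yb]]] [c [d [nuc nud zd]]]|
  s y [a [b [nua nub yb]]]].
- by exists 0, 1; split; rewrite ?mul0r //; exact: ideal0.
- exists (a * d + c * b), (b * d); split; [|exact: nuP|].
    by apply: idealD => //; apply: idealMr.
  have -> : int_val (a * d + c * b) =
      int_val a * int_val d + int_val c * int_val b by [].
  have -> : int_val (b * d) = int_val b * int_val d by [].
  have -> : sint_val (y + z) = sint_val y + sint_val z by [].
  by rewrite -yb -zd mulrDl !mulrA; congr (_ + _); rewrite mulrAC.
- have /asboolP/(_ nu nuS)[c [d [nud sd]]] := valP s.
  exists (c * a), (d * b); split; [exact: idealMl|exact: nuP|].
  have -> : int_val (c * a) = int_val c * int_val a by [].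
  have -> : int_val (d * b) = int_val d * int_val b by [].
  have -> : sint_val (s * y) = sint_val s * sint_val y by [].
  by rewrite -sd -yb mulrACA.
Qed.

Lemma sprime_proper (nu : finite_place K) :
  ~ S (FinPlace nu) -> ~ @sprime K S nu 1.
Proof.
move=> nuS /(sprime_local nuS)[a [b [nua nub]]].
by rewrite mul1r => /val_inj ba; apply: nub; rewrite ba.
Qed.

Lemma sprime_norm_gt0 (nu : finite_place K) :
  (0 < ideal_norm (@sprime K S nu))%N.
Proof.
have [p pp nup] := finite_place_prime nu.
apply: (@ideal_norm_gt0 K _ (sint_incl S) _ p) => //.
- exact: sprime_ideal.
- exact: sprime_nat.
Qed.

Hypothesis K1 : \dim {:K} = 1%N.

Lemma sprime_norm_dim1 (nu : finite_place K) (p : nat) :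
  ~ S (FinPlace nu) -> prime p -> fp_ideal nu p%:R ->
  ideal_norm (@sprime K S nu) = p.
Proof.
move=> nuS pp nup; apply: (@ideal_norm_dim1 K _ (sint_incl S)) => //.
- exact: sprime_ideal.
- exact: sprime_nat.
- exact: sprime_proper.
Qed.

(** With $ac=d$ in integers and $p \nmid c$, having $a$ in the prime forces $p \mid d$, which in
    turn puts $a$ in every prime over $p$. *)
Lemma finite_place_inj (nu nu' : finite_place K) (p : nat) : prime p ->
  fp_ideal nu p%:R -> fp_ideal nu' p%:R -> nu = nu'.
Proof.
move=> pp nup nup'.
suff nuE : fp_ideal nu = fp_ideal nu'.
  case: nu nu' nuE {nup nup'} => [I Ip In] [I' Ip' In'] /= II'; subst I'.
  by congr FinitePlace; exact: Prop_irrelevance.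
suff sub (mu mu' : finite_place K) : fp_ideal mu p%:R -> fp_ideal mu' p%:R ->
    fp_ideal mu `<=` fp_ideal mu'.
  by apply/seteqP; split; apply: sub.
move=> {nu nu' nup nup'} mup mup' a mua.
have [muid mu1 _] := fp_prime mu; have [mu'id mu'1 mu'M] := fp_prime mu'.
have [c [d [ad pc]]] := dim1_relation (@int_incl_inj K) muid pp mup K1 mu1 a.
have pd : (p %| d)%Z.
  by apply/(ideal_int muid pp mu1 mup); rewrite -ad; apply: idealMz.
have : fp_ideal mu' (a * c%:~R).
  by rewrite mulrzr ad; apply/(ideal_int mu'id pp mu'1 mup').
by move=> /mu'M[//|/(ideal_int mu'id pp mu'1 mup')]; rewrite (negPf pc).
Qed.

(** Some nonzero integer $d$ is a multiple of $e$ up to sign; the residue characteristics of the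
    places in question divide $d$, and each belongs to one place. *)
Lemma finite_sprime_dim1 (e : sintegers S) : e <> 0 ->
  finite_set [set nu | ~ S (FinPlace nu) /\ @sprime K S nu e].
Proof.
move=> e0.
(* The prime $2$ is an arbitrary choice; it only guarantees that the relation is nontrivial. *)
have [|c [c0 [j pj]]] := @ring_relation K _ _ 2 (@sint_incl_inj K S) isT 2
    (fun i => if i == ord0 then e else 1); first by rewrite K1.
move: c0; rewrite big_ord_recl big_ord1 /= => /eqP; rewrite addr_eq0 => /eqP.
set d := c (lift ord0 ord0) => ed.
have edK : val e * (c ord0)%:~R = - d%:~R.
  have /(congr1 (sint_incl S)) := ed.
  by rewrite rmorphMz rmorphN rmorph_int mulrzr.
have d0 : d != 0.
  apply: contra pj => /eqP d0; move: edK; rewrite d0 oppr0 => /eqP.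
  rewrite mulf_eq0 => /orP[/eqP e0'|]; first by case: e0; exact: val_inj.
  rewrite -(rmorph_int (in_alg K)) fmorph_eq0 intr_eq0 => /eqP c0.
  by have [i ->|->] := unliftP ord0 j; rewrite ?ord1 ?c0 // -/d d0.
have /choice[pr prP] (nu : finite_place K) :
    exists p, prime p /\ fp_ideal nu p%:R.
  by have [p ? ?] := finite_place_prime nu; exists p.
apply: (@sub_finite_set _ _ (pr @^-1` `I_(`|d|.+1)%N)); last first.
  apply: finite_preimage => // nu nu' _ _ prE; have [pp nup] := prP nu.
  by apply: (finite_place_inj pp nup); rewrite prE; have [] := prP nu'.
move=> nu [nuS /(sprime_local nuS)[a [b [nua nub eb]]]] /=.
have [pp nup] := prP nu; have [nuid nu1 nuM] := fp_prime nu.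
rewrite ltnS; apply: dvdn_leq; first by rewrite absz_gt0.
suff : fp_ideal nu (d%:~R * b) by case/nuM => // /(ideal_int nuid pp nu1 nup).
have -> : d%:~R * b = - ((c ord0)%:~R * a).
  apply: int_incl_inj; rewrite rmorphN !rmorphM !rmorph_int /= -eb.
  by rewrite -[d%:~R]opprK -edK mulrA [_ * val e]mulrC mulNr.
by apply: idealN => //; apply: idealMl.
Qed.

End SPrimes.

(** * Sections of the model and their coincidence *)

Section Sections.
Variables (K : fieldExtType rat) (S : set (place K)) (X : zfunctor_over K).
Variable M : smooth_proper_model S X.

(** The equations of the coincidence locus vanish in $K$, hence in the subring of $S$-integers, so
    the identity map factors through the locus. *)
Lemma extends_pt_unique (P : rat_pt X) (x y : M (sintegers S)) :
  extends_pt P x -> extends_pt P y -> x = y.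
Proof.
move=> [x1 xP] [y1 yP]; have [_ sepM _] := spm_proper M.
have [|E EP] := sepM _ x y; first by move=> s; rewrite x1 y1.
have E0 e : E e -> e = 0.
  move=> Ee; apply: sint_incl_inj; rewrite rmorph0.
  by apply: (EP K (sint_incl S)).1 Ee; rewrite xP yP.
have := (EP _ (GRing.RMorphism.clone _ _ idfun _)).2 E0.
by rewrite !zmap_id.
Qed.

(** A point of the generic fibre is a pair whose second entry, the structure map, is the identity
    for rational points. *)
Lemma generic_pt_inj (P Q : rat_pt X) :
  (sval (spm_generic M K (sval P))).1 = (sval (spm_generic M K (sval Q))).1 ->
  P = Q.
Proof.
move=> PQ.
suff : spm_generic M K (sval P) = spm_generic M K (sval Q).
  move/(bij_inj (spm_generic_iso M K)).
  case: P Q {PQ} => [x x1] [y y1] /= xy; subst y.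
  by congr exist; exact: Prop_irrelevance.
have idP (R : rat_pt X) : (sval (spm_generic M K (sval R))).2 =1 id.
  by move=> a; rewrite -[RHS](svalP R a) -(spm_generic_over M).
move: PQ (idP P) (idP Q).
case: (spm_generic M K (sval P)) => [[x f] xf].
case: (spm_generic M K (sval Q)) => [[y g] yg] /= xy f1 g1.
by apply: eq_exist; rewrite xy; congr pair; apply: rmorph_ext => a; rewrite f1.
Qed.

(* Separatedness: the locus where two sections agree is closed, and it misses
   the generic point when the sections are distinct. *)
Lemma intersection_mult_support (P Q : rat_pt X) : P <> Q ->
  exists2 e : sintegers S, e <> 0 &
    forall nu, intersection_mult M nu P Q <> 0%N -> @sprime K S nu e.
Proof.
move=> PQ.
(* [xget] defaults to $0$, so a nonzero value is a genuine order of coincidence. *)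
have multP nu : intersection_mult M nu P Q <> 0%N ->
    exists2 n, (0 < n)%N & coincide M nu P Q n.
  rewrite /intersection_mult; case: xgetP => // n _ [coin _] n0.
  by exists n => //; rewrite lt0n; apply/eqP.
(* Sections through [P] and [Q] come from a place of nonzero multiplicity; if there is none, $e=1$
   works vacuously. *)
have [[nu0 n0]|none] := pselect (exists nu, intersection_mult M nu P Q <> 0%N);
  last first.
  exists 1; first by apply/eqP; rewrite oner_eq0.
  by move=> nu n0; case: none; exists nu.
have [_ _ [x [y [_ [_ [xP yQ _ _]]]]]] := multP _ n0.
have [_ sepM _] := spm_proper M.
have [|E EP] := sepM _ x y.
  by move=> s; rewrite xP.1 yQ.1.
have [e Ee e0] : exists2 e, E e & e <> 0.
  apply: contrapT => noE; apply/PQ/generic_pt_inj; rewrite -xP.2 -yQ.2.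
  apply/(EP K (sint_incl S)) => e Ee; have [->|/eqP e0] := eqVneq e 0.
    exact: rmorph0.
  by case: noE; exists e.
exists e => // nu /multP[n n_gt0 [x' [y' [B [pi [x'P y'Q [_ pi0] xy]]]]]].
apply: (ideal_pow_sub (sprime_ideal S nu) n_gt0); apply/pi0.
apply: (EP B pi).1 Ee.
by rewrite (extends_pt_unique xP x'P) (extends_pt_unique yQ y'Q).
Qed.

End Sections.

(** * Power-free parts of natural numbers *)

Lemma free_part_pow (m d : nat) : (0 < m)%N -> (0 < d)%N ->
  free_part m (d ^ m)%N = 1%N.
Proof.
move=> m0 d0; have dm0 : (0 < d ^ m)%N by rewrite expn_gt0 d0.
rewrite /free_part.
suff -> : (\max_(e < (d ^ m).+1 | e ^ m %| d ^ m) e ^ m = d ^ m)%N.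
  by rewrite divnn dm0.
apply/eqP; rewrite eqn_leq; apply/andP; split.
  by apply/bigmax_leqP => e; exact: dvdn_leq.
(* The maximum ranges over bases up to $d^m$; $d$ is among them because $m>0$. *)
have ddm : (d < (d ^ m).+1)%N by rewrite ltnS -{1}(expn1 d) leq_pexp2l.
exact: (@leq_bigmax_cond _ _ (fun e : 'I_(d ^ m).+1 => (e ^ m)%N)
  (Ordinal ddm)).
Qed.

Lemma free_part_eq1 (m n : nat) : free_part m n = 1%N ->
  exists d, n = (d ^ m)%N.
Proof.
rewrite /free_part; case: n => [|n]; first by rewrite div0n.
have one : (1 < n.+2)%N by [].
(* The base $1$ is admissible, so the maximum is attained; a quotient $1$ then makes the number
   equal to that power. *)
have [|e eP ->] := @eq_bigmax_cond _ [pred e : 'I_n.+2 | (e ^ m %| n.+1)%N]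
    (fun e => (e ^ m)%N).
  by apply/card_gt0P; exists (Ordinal one); rewrite !inE exp1n.
by move=> en; exists e; have := divnK eP; rewrite en mul1n.
Qed.

(** * Prime factorization of [lambda] *)

Section Lambda.
Variables (K : fieldExtType rat) (S : set (place K)) (X : zfunctor_over K).
Variables (M : smooth_proper_model S X) (P t : rat_pt X).

Lemma lambda_pow (m : nat) :
  (forall nu, ~ S (FinPlace nu) -> m %| intersection_mult M nu t P)%N ->
  exists2 d, (0 < d)%N & lambda M P t = (d ^ m)%N.
Proof.
move=> mP; rewrite /lambda big_seq; elim/big_ind: _.
- by exists 1%N; rewrite ?exp1n.
- move=> _ _ [d d0 ->] [e e0 ->]; exists (d * e)%N; last by rewrite expnMn.
  by rewrite muln_gt0 d0.
(* With infinite support the list of factors is empty; otherwise each exponent is $km$. *)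
- move=> nu; case: finite_supportP => // Y YP _ _ nuY.
  have /dvdnP[k ->] := mP nu (YP nu nuY).
  exists (ideal_norm (@sprime K S nu) ^ k)%N; last by rewrite expnM.
  by rewrite expn_gt0 sprime_norm_gt0.
Qed.

Lemma logn_lambda (nu : finite_place K) (p : nat) :
  \dim {:K} = 1%N -> t <> P -> ~ S (FinPlace nu) -> prime p ->
  fp_ideal nu p%:R -> logn p (lambda M P t) = intersection_mult M nu t P.
Proof.
move=> K1 tP nuS pp nup.
pose F mu := (ideal_norm (@sprime K S mu) ^ intersection_mult M mu t P)%N.
pose D := [set mu : finite_place K | ~ S (FinPlace mu)].
(* A factor other than $1$ needs nonzero multiplicity, hence a place containing the nonzero element
   [e]. *)
have fin : finite_set (D `&` F @^-1` [set~ 1%N]).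
  have [e e0 eP] := intersection_mult_support M tP.
  apply: sub_finite_set (finite_sprime_dim1 K1 e0) => mu [muS /= mu1].
  by split=> //; apply: eP => mu0; apply: mu1; rewrite /F mu0 expn0.
have normE := sprime_norm_dim1 K1 nuS pp nup.
rewrite /lambda -/D.
(* Other places have norms that are primes different from $p$, so only the factor at [nu]
   contributes to the valuation. *)
have cop (s : seq (finite_place K)) : nu \notin s ->
    {in s, forall mu, ~ S (FinPlace mu)} ->
    coprime p (\prod_(mu <- s) F mu)%N.
  move=> nus sS; rewrite big_seq; elim/big_ind: _ => [|x y cx cy|mu mus].
  - exact: coprimen1.
  - by rewrite coprimeMr cx.
  apply: coprimeXr; have [q qp muq] := finite_place_prime mu.
  rewrite (sprime_norm_dim1 K1 (sS mu mus) qp muq) prime_coprime //.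
  rewrite dvdn_prime2 //; apply: contraNneq nus => pq.
  by rewrite (finite_place_inj K1 pp nup (_ : fp_ideal mu _)) // pq.
have supS : {in finite_support 1%N D F, forall mu, ~ S (FinPlace mu)}.
  by move=> mu; rewrite in_finite_support // inE => -[].
have [nuin|nuout] := boolP (nu \in finite_support 1%N D F).
  rewrite (bigD1_seq nu) ?finite_support_uniq //= -big_filter.
  rewrite normE mulnC logn_Gauss ?pfactorK //.
  apply: cop; first by rewrite mem_filter eqxx.
  by move=> mu; rewrite mem_filter => /andP[_]; exact: supS.
(* Off the support the factor at [nu], a power of $p$, equals $1$, so the multiplicity is $0$. *)
rewrite logn_coprime; last exact: cop.
move: nuout; rewrite in_finite_support // notin_setE /= /F normE.
case: (intersection_mult M nu t P) => // k; case; split=> //= /eqP.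
by rewrite gtn_eqF // -(exp1n k.+1) ltn_exp2r // prime_gt1.
Qed.

End Lambda.

(** * Integral points versus trivial power-free parts *)

Theorem theorem2p3 (K : fieldExtType rat) (X : mcurve K)
    (r : nat) (P : 'I_r -> rat_pt X) (m : 'I_r -> nat)
    (P_inj : injective P)
    (m_gt1 : forall i, (1 < m i)%N)
    (mult_P : forall i, mc_mult (P i) = Mfin (m i))
    (mult_other : forall Q : rat_pt X, (forall i, Q <> P i) ->
       mc_mult Q = Mfin 1)
    (S : set (place K)) (S_fin : finite_set S)
    (S_inf : forall w : infinite_place K, S (InfPlace w))
    (S_bad : forall nu : finite_place K, bad_reduction X nu ->
       S (FinPlace nu))
    (M : smooth_proper_model S X) :
  integral_points M `<=`
    \bigcap_(Q in [set Q : rat_pt X | mult_gt1 (mc_mult Q)])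
      H_trivial_points M Q
  /\
  (\dim {:K} = 1%N ->
   integral_points M =
     \bigcap_(Q in [set Q : rat_pt X | mult_gt1 (mc_mult Q)])
       H_trivial_points M Q).
Proof.
have multE (Q : rat_pt X) : exists2 n, mc_mult Q = Mfin n & (0 < n)%N.
  have [[i ->]|/forallNP QP] := pselect (exists i, Q = P i).
    by exists (m i) => //; exact: ltnW.
  by exists 1%N => //; exact: mult_other.
have sub : integral_points M `<=`
    \bigcap_(Q in [set Q : rat_pt X | mult_gt1 (mc_mult Q)])
      H_trivial_points M Q.
  move=> t tint Q /=; rewrite /H_trivial_points /H_part /=.
  have [n QE n0] := multE Q; rewrite QE /= => n1 tQ.
  rewrite gtn_eqF //; have [|d d0 ->] := @lambda_pow _ _ _ M Q t n.
    by move=> nu nuS; have := tint Q (nesym tQ) nu nuS; rewrite QE.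
  exact: free_part_pow.
split=> // K1; apply/seteqP; split=> // t tH Q Qt nu nuS.
have [n QE n0] := multE Q; rewrite QE /=.
(* Points of multiplicity $1$ impose only a congruence modulo $1$. *)
have [n1|n1] := leqP n 1.
  by case: n n0 n1 {QE} => [|[]].
have := tH Q; rewrite /= /H_trivial_points /H_part /= QE /= gtn_eqF //.
move=> /(_ n1 (nesym Qt))/free_part_eq1[d lE].
(* The multiplicity at [nu] is $v_p(d^n) = n\,v_p(d)$. *)
have [p pp nup] := finite_place_prime nu.
rewrite -(logn_lambda M K1 (nesym Qt) nuS pp nup) lE lognX.
exact: dvdn_mulr.
Qed.
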